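(* (Kantorovich–Rubinstein duality.) Let $(X,d,x_0)$ be a pointed metric space and let $\sum_{i=1}^n a_i,\ \sum_{j=1}^m b_j\in D(X,x_0)$. Then $$W_1[d,x_0]\Big(\sum_{i=1}^n a_i,\ \sum_{j=1}^m b_j\Big)=\sup\Big\{\sum_{i=1}^n k(a_i)-\sum_{j=1}^m k(b_j)\Big\},$$ where the supremum is taken over all $1$-Lipschitz functions $k:X\to\mathbb{R}$ with $k(x_0)=0$.
   Context: A metric space is a pair $(X,d)$ with $X$ a set and $d:X\times X\to[0,\infty]$ satisfying $d(x,x)=0$, $d(x,y)=d(y,x)$ and $d(x,y)\le d(x,z)+d(z,y)$ (an extended pseudometric). A pointed metric space $(X,d,x_0)$ is a metric space with a basepoint $x_0\in X$. A function $k:X\to\mathbb{R}$ is $1$-Lipschitz if $|k(x)-k(y)|\le d(x,y)$ for all $x,y\in X$. $D(X)$ is the free commutative monoid on $X$ (finite formal sums of elements of $X$). $D(X,x_0):=D(X)/D(\{x_0\})$ is the quotient monoid, where $\alpha\sim\beta$ iff $\alpha+\xi=\beta+\eta$ for some $\xi,\eta\in D(\{x_0\})$; thus $D(X,x_0)\cong D(X\setminus\{x_0\})$. The $1$-Wasserstein distance on $D(X,x_0)$ is $$W_1[d,x_0](x_1+\cdots+x_m,\,x_1'+\cdots+x_n')=\min_{\sigma\in\Sigma_{m+n}}\sum_{k=1}^{m+n}d(x_k,x'_{\sigma(k)}),$$ where $x_{m+1}=\cdots=x_{m+n}=x'_{n+1}=\cdots=x'_{n+m}=x_0$ and $\Sigma_{m+n}$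 is the symmetric group. *)

(* Defs.v *)
From HB Require Import structures.
From mathcomp Require Import all_boot all_order all_algebra all_fingroup.
From mathcomp Require Import generic_quotient finmap multiset.
From mathcomp Require Import all_classical all_reals ereal sequences.

Set Implicit Arguments.
Unset Strict Implicit.
Unset Printing Implicit Defensive.
Import Order.TTheory GRing.Theory Num.Theory.
Local Open Scope ring_scope.
Local Open Scope quotient_scope.

(** "Metric" is meant in the wide sense: the value +oo is allowed, and
    d x y = 0 need not force x = y. *)
Record metric (R : realType) (X : Type) := Metric {
  mdist :> X -> X -> \bar R ;
  mdist_ge0 : forall x y, (0 <= mdist x y)%E ;
  mdist_refl : forall x, mdist x x = 0%E ;
  mdist_sym : forall x y, mdist x y = mdist y x ;
  mdist_triangle : forall x y z, (mdist x y <= mdist x z + mdist z y)%E }.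

Definition lipschitz1 (R : realType) (X : Type) (d : metric R X) (k : X -> R) :=
  forall x y, (`|k x - k y|%:E <= d x y)%E.

(** The free commutative monoid on [X], as finite multisets. *)
Definition D (X : choiceType) := {mset X}%mset.

HB.instance Definition _ (X : choiceType) := Choice.on (D X).
HB.instance Definition _ (X : choiceType) :=
  @GRing.isNmodule.Build (D X) (@mset0 X) (@msetD X)
    (@msetDA X) (@msetDC X) (@mset0D X).

Section RelativeDiagrams.
Variables (X : choiceType) (x0 : X).

(** The elements of D({x0}) are the multisets [msetn p x0]. *)
Definition Drel (alpha beta : D X) : bool :=
  `[< exists p q : nat,
        alpha + (msetn p x0 : D X) = beta + (msetn q x0 : D X) >].

Fact msetn_add (p q : nat) :
  (msetn (p + q) x0 : D X) = (msetn p x0 : D X) + (msetn q x0 : D X).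
Proof.
by apply/msetP => y; rewrite msetE2 !msetnE; case: (y == x0).
Qed.

Fact Drel_refl : reflexive Drel.
Proof. by move=> a; apply/asboolP; exists 0%N, 0%N. Qed.

Fact Drel_sym : symmetric Drel.
Proof.
by move=> a b; apply/asboolP/asboolP => -[p [q e]]; exists q, p; rewrite e.
Qed.

Fact Drel_trans : transitive Drel.
Proof.
move=> b a c /asboolP [p [q e]] /asboolP [p' [q' e']]; apply/asboolP.
exists (p + p')%N, (q' + q)%N.
by rewrite !msetn_add !addrA e [LHS]addrAC e'.
Qed.

Canonical Drel_equiv := EquivRel Drel Drel_refl Drel_sym Drel_trans.

(** D(X, x0) = D(X) / D({x0}). *)
Definition Dpt := {eq_quot Drel}.

HB.instance Definition _ := Choice.on Dpt.
HB.instance Definition _ := EqQuotient.on Dpt.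

Lemma DptP (a b : D X) :
  reflect (exists p q : nat,
             a + (msetn p x0 : D X) = b + (msetn q x0 : D X))
          (\pi_Dpt a == \pi_Dpt b).
Proof. by rewrite eqmodE; apply: asboolP. Qed.

Definition Dpt_zero : Dpt := \pi_Dpt 0.
Definition Dpt_add (u v : Dpt) : Dpt := \pi_Dpt (repr u + repr v).

Fact Dpt_addE (a b : D X) :
  Dpt_add (\pi_Dpt a) (\pi_Dpt b) = \pi_Dpt (a + b).
Proof.
rewrite /Dpt_add; apply/eqP.
case: (piP Dpt a) => a' /eqP /DptP [p [q e]].
case: (piP Dpt b) => b' /eqP /DptP [p' [q' e']].
apply/DptP; exists (q + q')%N, (p + p')%N.
by rewrite !msetn_add [LHS]addrACA [RHS]addrACA -e -e'.
Qed.

Fact Dpt_addA : associative Dpt_add.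
Proof.
move=> u v w; rewrite -(reprK u) -(reprK v) -(reprK w).
by rewrite (Dpt_addE (repr v)) (Dpt_addE (repr u) (repr v)) !Dpt_addE addrA.
Qed.

Fact Dpt_addC : commutative Dpt_add.
Proof. by move=> u v; rewrite /Dpt_add addrC. Qed.

Fact Dpt_add0 : left_id Dpt_zero Dpt_add.
Proof.
by move=> u; rewrite -(reprK u) /Dpt_zero Dpt_addE add0r.
Qed.

HB.instance Definition _ :=
  @GRing.isNmodule.Build Dpt Dpt_zero Dpt_add Dpt_addA Dpt_addC Dpt_add0.

(** The class of the generator [x]. *)
Definition gen (x : X) : Dpt := \pi_Dpt ([mset x]%mset : D X).

Lemma gen_sumE (n : nat) (a : 'I_n -> X) :
  \sum_(i < n) gen (a i) = \pi_Dpt (seq_mset (codom a) : D X).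
Proof.
have step (s : seq X) : \sum_(x <- s) gen x = \pi_Dpt (seq_mset s : D X).
  elim: s => [|x s IH].
    by rewrite big_nil; congr (\pi_Dpt _); apply/msetP => y;
       rewrite mset_seqE mset0E.
  rewrite big_cons IH [LHS]Dpt_addE; congr (\pi_Dpt _); apply/msetP => y.
  by rewrite mset_seqE msetE2 msetnE mset_seqE /= eq_sym; case: eqP.
by rewrite -step codomE big_map big_enum.
Qed.

End RelativeDiagrams.

Section Wasserstein.
Variables (R : realType) (X : choiceType) (d : metric R X) (x0 : X).
Local Open Scope ereal_scope.

(** [nth x0] returns the basepoint beyond the end of a list, which performs
    the padding. [+oo] is only the neutral element of [mine]: the index set
    of the minimum is never empty. *)
Definition matching_cost (N : nat) (s t : seq X) : \bar R :=
  \big[mine/+oo]_(sigma : 'S_N) \sum_(i < N) d (nth x0 s i) (nth x0 t (sigma i)).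

Definition W1_seq (s t : seq X) : \bar R := matching_cost (size s + size t) s t.

(** [W1E] below shows that the choice of representatives is irrelevant. *)
Definition W1 (u v : Dpt x0) : \bar R :=
  W1_seq (enum_mset (repr u)) (enum_mset (repr v)).

Lemma matching_cost_le N s t (sigma : 'S_N) :
  matching_cost N s t <= \sum_(i < N) d (nth x0 s i) (nth x0 t (sigma i)).
Proof. exact: bigmin_le_cond. Qed.

Lemma le_matching_cost N s t c :
  (forall sigma : 'S_N,
     c <= \sum_(i < N) d (nth x0 s i) (nth x0 t (sigma i))) ->
  c <= matching_cost N s t.
Proof. by move=> h; apply: le_bigmin => [|sigma _]; [exact: leey|exact: h]. Qed.

Lemma matching_costC N s t : matching_cost N s t = matching_cost N t s.
Proof.
suff le s' t' : matching_cost N s' t' <= matching_cost N t' s'.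
  by apply/eqP; rewrite eq_le !le.
apply: le_matching_cost => sigma.
apply: le_trans (matching_cost_le _ _ sigma^-1%g) _.
rewrite (reindex_inj (@perm_inj _ sigma)) /=.
by apply: lee_sum => i _; rewrite permK mdist_sym.
Qed.

Lemma eq_matching_cost N s s' t :
  nth x0 s =1 nth x0 s' -> matching_cost N s t = matching_cost N s' t.
Proof.
by move=> e; apply: eq_bigr => sigma _; apply: eq_bigr => i _; rewrite e.
Qed.

Lemma nth_pad s p : nth x0 (s ++ nseq p x0) =1 nth x0 s.
Proof.
move=> i; rewrite nth_cat; case: ltnP => // le; rewrite nth_nseq if_same.
by rewrite nth_default.
Qed.

Lemma perm_matching_cost N s s' t : (size s <= N)%N -> perm_eq s s' ->
  matching_cost N s t = matching_cost N s' t.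
Proof.
move=> sN ss'.
suff le r r' : (size r <= N)%N -> perm_eq r r' ->
    matching_cost N r t <= matching_cost N r' t.
  apply/eqP; rewrite eq_le !le //; last by rewrite perm_sym.
  by rewrite -(perm_size ss').
move=> rN rr'.
pose w := r ++ nseq (N - size r) x0; pose w' := r' ++ nseq (N - size r) x0.
have ww' : perm_eq w w' by rewrite perm_cat2r.
have szw : size w == N by rewrite size_cat size_nseq subnKC.
have szw' : size w' == N by rewrite -(perm_size ww').
rewrite -(eq_matching_cost N t (nth_pad r (N - size r))).
rewrite -(eq_matching_cost N t (nth_pad r' (N - size r))) -/w -/w'.
have /tuple_permP [q e] : perm_eq (Tuple szw') (Tuple szw).
  by rewrite perm_sym.
have nthw' (i : 'I_N) : nth x0 w' i = nth x0 w (q i).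
  have := congr1 (fun z => nth x0 z i) e.
  rewrite /= (nth_map i) ?size_enum_ord // nth_ord_enum (tnth_nth x0) /=.
  by [].
apply: le_matching_cost => sigma.
apply: le_trans (matching_cost_le _ _ (q^-1 * sigma)%g) _.
rewrite (reindex_inj (@perm_inj _ q)) /=.
by apply: lee_sum => i _; rewrite permM permK nthw'.
Qed.

Lemma matching_costS N s t : (size s <= N)%N -> (size t <= N)%N ->
  matching_cost N.+1 s t = matching_cost N s t.
Proof.
move=> sN tN.
have s0 : nth x0 s (@ord_max N) = x0 by rewrite nth_default.
have t0 : nth x0 t (@ord_max N) = x0 by rewrite nth_default.
have liftmax (i : 'I_N) : lift ord_max i = i :> nat.
  by rewrite /= /bump leqNgt ltn_ord.
have costlift (sigma : 'S_N) :
    \sum_(i < N.+1)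
       d (nth x0 s i) (nth x0 t (lift_perm ord_max ord_max sigma i)) =
    \sum_(i < N) d (nth x0 s i) (nth x0 t (sigma i)).
  rewrite big_ord_recr /= lift_perm_id s0 t0 mdist_refl adde0.
  apply: eq_bigr => i _.
  have -> : widen_ord (leqnSn N) i = lift ord_max i.
    by apply: val_inj; exact: (esym (liftmax i)).
  by rewrite lift_perm_lift !liftmax.
apply/eqP; rewrite eq_le; apply/andP; split; apply: le_matching_cost.
  by move=> sigma; rewrite -costlift; exact: matching_cost_le.
move=> tau.
pose tau' : 'S_N.+1 := (tau * tperm (tau ord_max) ord_max)%g.
have tau'max : tau' ord_max = ord_max by rewrite permM tpermL.
have [sigma sigmaE] : exists sigma : 'S_N, tau' = lift_perm ord_max ord_max sigma.
  pose f (k : 'I_N) : 'I_N := odflt k (unlift ord_max (tau' (lift ord_max k))).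
  have fE k : lift ord_max (f k) = tau' (lift ord_max k).
    rewrite /f; case: unliftP => [j -> //|e].
    have /perm_inj/eqP : tau' (lift ord_max k) = tau' ord_max by rewrite tau'max.
    by rewrite eq_sym (negbTE (neq_lift _ _)).
  have f_inj : injective f.
    move=> k l e; apply: (@lift_inj _ ord_max); apply: (@perm_inj _ tau').
    by rewrite -fE -[RHS]fE e.
  exists (perm f_inj); apply/permP => i.
  case: (unliftP ord_max i) => [j ->|->].
    by rewrite lift_perm_lift -fE [perm f_inj j]permE.
  by rewrite lift_perm_id.
apply: le_trans (matching_cost_le s t sigma) _.
rewrite -costlift -sigmaE.
pose i0 := (tau^-1)%g ord_max.
have tau_i0 : tau i0 = ord_max by rewrite permKV.
have [e|ne] := eqVneq i0 ord_max.
  suff -> : tau' = tau by [].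
  by rewrite /tau' -{1}e tau_i0 tperm1 mulg1.
rewrite (bigD1 ord_max) //= (bigD1 i0) //=.
rewrite [leRHS](bigD1 ord_max) //= [in leRHS](bigD1 i0) //= !addeA.
apply: leeD; last first.
  apply: lee_sum => i /andP [im ii0].
  rewrite permM tpermD //.
    by apply/negP => /eqP /perm_inj e; rewrite e eqxx in im.
  by rewrite -tau_i0; apply/negP => /eqP /perm_inj e; rewrite e eqxx in ii0.
rewrite tau'max s0 t0 mdist_refl add0e permM tau_i0 tpermR t0.
by rewrite addeC; exact: mdist_triangle.
Qed.

Lemma matching_cost_pad N p s t : (size s <= N)%N -> (size t <= N)%N ->
  matching_cost (N + p) s t = matching_cost N s t.
Proof.
move=> sN tN; elim: p => [|p IH]; first by rewrite addn0.
by rewrite addnS matching_costS ?IH //; apply: leq_trans (leq_addr _ _).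
Qed.

Lemma W1_seqE N s t : (size s <= N)%N -> (size t <= N)%N ->
  W1_seq s t = matching_cost N s t.
Proof.
move=> sN tN; rewrite -(matching_cost_pad (size s + size t) sN tN) addnC.
by rewrite matching_cost_pad // ?leq_addr ?leq_addl.
Qed.

Lemma W1_seqC s t : W1_seq s t = W1_seq t s.
Proof. by rewrite /W1_seq addnC matching_costC. Qed.

Lemma W1_seq_pi s s' t :
  \pi_(Dpt x0) (seq_mset s : D X) = \pi_(Dpt x0) (seq_mset s' : D X) ->
  W1_seq s t = W1_seq s' t.
Proof.
move=> /eqP /DptP [p [q e]].
have perm_pad : perm_eq (s ++ nseq p x0) (s' ++ nseq q x0).
  apply/eq_seq_msetP/msetP => y.
  have /= := congr1 (fun M : D X => (M : {mset X}%mset) y) e.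
  rewrite !msetE2 !msetnE !mset_seqE !count_cat !count_nseq /= => e'.
  by move: e'; rewrite eq_sym; case: eqP; rewrite ?mul1n ?mul0n.
pose N := (size (s ++ nseq p x0) + size (s' ++ nseq q x0) + size t)%N.
have leN : (size (s ++ nseq p x0) <= N)%N by rewrite /N -addnA leq_addr.
have leN' : (size (s' ++ nseq q x0) <= N)%N.
  by rewrite /N addnAC leq_addl.
have tN : (size t <= N)%N by exact: leq_addl.
rewrite (@W1_seqE N) //; last first.
  by apply: leq_trans leN; rewrite size_cat leq_addr.
rewrite (@W1_seqE N) //; last first.
  by apply: leq_trans leN'; rewrite size_cat leq_addr.
rewrite -(eq_matching_cost _ _ (nth_pad s p)).
rewrite -(eq_matching_cost _ _ (nth_pad s' q)).
exact: perm_matching_cost.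
Qed.

Lemma W1E (m n : nat) (x : 'I_m -> X) (y : 'I_n -> X) :
  W1 (\sum_(i < m) gen x0 (x i))%R (\sum_(j < n) gen x0 (y j))%R =
  W1_seq (codom x) (codom y).
Proof.
rewrite !gen_sumE /W1.
rewrite (@W1_seq_pi _ (codom x)); last by rewrite seq_mset_id reprK.
rewrite W1_seqC (@W1_seq_pi _ (codom y)); last by rewrite seq_mset_id reprK.
exact: W1_seqC.
Qed.

End Wasserstein.

(* Main.v *)
Require Import Defs.
From mathcomp Require Import all_boot all_order all_algebra perm lra.
From mathcomp Require Import all_classical all_reals ereal.
Import Order.TTheory GRing.Theory Num.Theory.
Local Open Scope ring_scope.

(** The inequality from right to left is immediate: after padding both sums
    with the basepoint, where [k] vanishes, every matching [sigma] satisfies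
    [k (s i) - k (t (sigma i)) <= d (s i) (t (sigma i))] term by term
    ([lipschitz1_le_matching_cost]).

    For the converse, suppose first that the distance [e] is real valued; some
    1-Lipschitz [k] then attains the cost.  Relabel the points so that an optimal
    matching pairs [p i] with [q i], and give the arc from [i] to [j] the
    weight [e (p i) (q j) - e (p i) (q i)], the price of rerouting [p i] to
    [q j].  Optimality says that no permutation has negative total weight,
    hence no simple cycle does, so minimal weights of simple walks form a
    potential [v] on the indices ([potential_exists]).  The lower envelope
    [k x = min_i (v i + e (q i) x)] is 1-Lipschitz and satisfies
    [k (p i) - k (q i) >= e (p i) (q i)] ([optimal_matching_dual]).

    Infinite distances are removed by truncation: [min (d, M)] is again a
    metric, its 1-Lipschitz functions are 1-Lipschitz for [d], and its
    matching cost is at least the minimum of [M] and the cost for [d].  Thus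
    the supremum dominates that minimum for every [M]
    ([matching_cost_trunc_dual]), hence dominates the cost, be it finite or
    not ([le_ereal_min_all]). *)

(** * Potentials on weighted digraphs without negative cycles *)

Section Potential.
Variables (R : realDomainType) (T : finType) (w : T -> T -> R).

Fixpoint walk_weight (x : T) (s : seq T) : R :=
  if s is y :: s' then w x y + walk_weight y s' else 0.

Lemma walk_weight_cat x s t :
  walk_weight x (s ++ t) = walk_weight x s + walk_weight (last x s) t.
Proof. by elim: s x => [|y s IH] x /=; rewrite ?add0r // IH addrA. Qed.

Lemma walk_weight_nth z x s : walk_weight x s =
  \sum_(i < size s) w (nth z (x :: s) i) (nth z s i).
Proof.
elim: s x => [|y s IH] x /=; first by rewrite big_ord0.
by rewrite big_ord_recl /= IH.
Qed.

(** A simple closed walk is read as the cyclic permutation [next] of its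
    vertices, which ties walks to the permutations of the optimality
    hypothesis. *)
Lemma walk_weight_next x c : uniq (x :: c) ->
  walk_weight x (rcons c x) = \sum_(y <- x :: c) w y (next (x :: c) y).
Proof.
move=> xc_uniq.
rewrite (walk_weight_nth x) size_rcons (big_nth x) big_mkord.
apply: eq_bigr => i _; rewrite -rcons_cons nth_rcons ltn_ord; congr (w _ _).
rewrite next_nth mem_nth // index_uniq // nth_rcons.
case: ltnP => [//|c_le]; rewrite [RHS]nth_default //.
by case: eqP => // _; rewrite if_same.
Qed.

Hypothesis w_refl : forall x, w x x = 0.
Hypothesis w_perm : forall s : {perm T}, 0 <= \sum_x w x (s x).

(** The cyclic permutation extends by the identity outside the cycle, at no
    cost because loops have weight zero. *)
Lemma walk_weight_cycle_ge0 x c : uniq (x :: c) -> 0 <= walk_weight x (rcons c x).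
Proof.
move=> xc_uniq; rewrite walk_weight_next // big_uniq //=.
have next_inj : injective (next (x :: c)) := can_inj (prev_next xc_uniq).
have := w_perm (perm next_inj); rewrite (bigID (mem (x :: c))) /=.
rewrite [X in _ + X]big1 ?addr0 => [|y yN].
  by under eq_bigr do rewrite permE.
by rewrite permE next_nth (negPf yN) w_refl.
Qed.

(** Simple walks have bounded length, so there are finitely many of them. *)
Lemma simple_walk_min x : exists s, uniq (x :: s) /\
  forall t, uniq (x :: t) -> walk_weight x s <= walk_weight x t.
Proof.
pose simple (s : #|T|.-bseq T) := uniq (x :: s).
have [//|s s_uniq s_min] :=
  @arg_minP _ _ _ [bseq] simple (fun s : #|T|.-bseq T => walk_weight x s).
exists s; split=> // t t_uniq.
have t_size : (size t <= #|T|)%N.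
  apply: ltnW; rewrite -[(size t).+1]/(size (x :: t)).
  by rewrite -(card_uniqP t_uniq) max_card.
exact: (s_min (Bseq t_size)).
Qed.

(** [v x] is the minimal weight of a simple walk from [x].  Prepending [x] to
    a minimal simple walk from [y] gives a simple walk, or else it closes a
    cycle through [x]; cutting off that cycle, of nonnegative weight, leaves a
    simple walk from [x] that is no heavier. *)
Lemma potential_exists : exists v : T -> R, forall x y, v x <= w x y + v y.
Proof.
have [s sP] := choice simple_walk_min.
exists (fun x => walk_weight x (s x)) => x y.
have [_ x_min] := sP x; have [y_uniq _] := sP y.
have [xNy|] := boolP (x \notin y :: s y).
  by apply: (x_min (y :: s y)); rewrite cons_uniq xNy.
rewrite negbK => x_in.
rewrite -[leRHS]/(walk_weight x (y :: s y)).
case/splitPr: x_in y_uniq => c t u.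
rewrite -cat_rcons walk_weight_cat last_rcons -[leLHS]add0r.
move: u; rewrite -cat_rcons cat_uniq rcons_uniq -cons_uniq.
case/and3P=> xc_uniq xcN t_uniq.
apply: lerD; first exact: walk_weight_cycle_ge0.
apply: x_min; rewrite cons_uniq t_uniq andbT; apply: contra xcN => xt.
by apply/hasP; exists x => //; rewrite mem_rcons mem_head.
Qed.
End Potential.

(** * Dual potentials for a real-valued distance *)

(** The potential [v] gives the intended values of [k] at the points [q i].
    The lower envelope of the cones [v i + e (q i) x] may fall below [v i] at
    [q i], but this only increases [k (p i) - k (q i)], and the potential
    inequality is exactly [k (p i) >= v i + e (p i) (q i)]. *)
Lemma optimal_matching_dual (R : realDomainType) (X : Type) (e : X -> X -> R)
    (e_refl : forall x, e x x = 0) (e_sym : forall x y, e x y = e y x)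
    (e_tri : forall x y z, e x y <= e x z + e z y)
    (N : nat) (p q : 'I_N -> X)
    (pq_opt : forall s : 'S_N,
       \sum_(i < N) e (p i) (q i) <= \sum_(i < N) e (p i) (q (s i))) :
  exists2 k : X -> R, (forall x y, `|k x - k y| <= e x y) &
    \sum_(i < N) e (p i) (q i) <= \sum_(i < N) (k (p i) - k (q i)).
Proof.
case: N p q pq_opt => [|N] p q pq_opt.
  exists (fun=> 0) => [x y|]; last by rewrite !big_ord0.
  (* The distance is nonnegative: [0 = e x x <= e x y + e y x = 2 * e x y]. *)
  rewrite subrr normr0 -(pmulrn_lge0 _ (ltn0Sn 1)) mulr2n.
  by rewrite {2}e_sym -(e_refl x) e_tri.
have [||v vP] := @potential_exists R 'I_N.+1
    (fun i j => e (p i) (q j) - e (p i) (q i)).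
- by move=> i; rewrite subrr.
- by move=> s; rewrite sumrB subr_ge0.
pose f i x := v i + e (q i) x.
pose k x := \big[Num.min/f ord0 x]_i f i x.
have k_le i x : k x <= f i x by exact: bigmin_le_cond.
have le_k c x : (forall i, c <= f i x) -> c <= k x.
  by move=> h; apply: le_bigmin.
exists k => [x y|].
  have half x' y' : k x' - k y' <= e x' y'.
    rewrite lerBlDl -lerBlDr; apply: le_k => i; rewrite lerBlDr.
    apply: le_trans (k_le i x') _; rewrite /f -addrA lerD2l.
    by rewrite (e_sym x') e_tri.
  by rewrite ler_norml half lerNl opprB e_sym half.
apply: ler_sum => i _; rewrite lerBrDr.
apply: (@le_trans _ _ (e (p i) (q i) + v i)).
  by rewrite lerD2l (le_trans (k_le i _)) // /f e_refl addr0.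
by apply: le_k => j; have := vP i j; rewrite /f (e_sym (q j)); lra.
Qed.

(** * Truncating a distance that may be infinite *)

Section Truncation.
Variables (R : realType) (X : Type) (d : metric R X) (M : R).
Hypothesis M_ge0 : 0 <= M.

Definition trunc_dist (x y : X) : R := fine (Order.min (d x y) M%:E).

Lemma trunc_distE x y : (trunc_dist x y)%:E = Order.min (d x y) M%:E.
Proof.
rewrite /trunc_dist fineK // fin_numElt.
apply/andP; split.
  apply: (@lt_le_trans _ _ 0%E); first exact: ltNy0.
  by rewrite le_min lee_fin M_ge0 andbT Defs.mdist_ge0.
by apply: (@le_lt_trans _ _ M%:E); rewrite ?ltry // ge_min lexx orbT.
Qed.

Lemma trunc_dist_ge0 x y : 0 <= trunc_dist x y.
Proof.
by rewrite -lee_fin trunc_distE le_min lee_fin M_ge0 andbT Defs.mdist_ge0.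
Qed.

Lemma trunc_dist_refl x : trunc_dist x x = 0.
Proof. by apply: EFin_inj; rewrite trunc_distE Defs.mdist_refl min_l. Qed.

Lemma trunc_dist_sym x y : trunc_dist x y = trunc_dist y x.
Proof. by rewrite /trunc_dist Defs.mdist_sym. Qed.

Lemma trunc_dist_triangle x y z :
  trunc_dist x y <= trunc_dist x z + trunc_dist z y.
Proof.
have leM a b : trunc_dist a b <= M.
  by rewrite -lee_fin trunc_distE ge_min lexx orbT.
have [dM|Md] := leP (d x z) M%:E; last first.
  have -> : trunc_dist x z = M.
    by apply: EFin_inj; rewrite trunc_distE min_r // ltW.
  by rewrite (le_trans (leM x y)) // lerDl trunc_dist_ge0.
have [dM'|Md] := leP (d z y) M%:E; last first.
  have -> : trunc_dist z y = M.
    by apply: EFin_inj; rewrite trunc_distE min_r // ltW.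
  by rewrite (le_trans (leM x y)) // lerDr trunc_dist_ge0.
rewrite -lee_fin EFinD !trunc_distE (min_l dM) (min_l dM').
by rewrite ge_min Defs.mdist_triangle.
Qed.

Lemma trunc_dist_lipschitz1 (k : X -> R) :
  (forall x y, `|k x - k y| <= trunc_dist x y) -> lipschitz1 d k.
Proof.
move=> kP x y; apply: (@le_trans _ _ (trunc_dist x y)%:E).
  by rewrite lee_fin.
by rewrite trunc_distE ge_min lexx.
Qed.

(** Either no term is truncated, and the two sums agree, or a single truncated
    term already contributes [M]. *)
Lemma trunc_dist_sum (I : finType) (p q : I -> X) :
  (Order.min (\sum_i d (p i) (q i)) M%:E <= (\sum_i trunc_dist (p i) (q i))%:E)%E.
Proof.
have [/forallP dM|/forallPn[i]] := boolP [forall i, (d (p i) (q i) <= M%:E)%E].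
  rewrite -sumEFin ge_min; apply/orP; left; apply: lee_sum => i _.
  by rewrite trunc_distE min_l.
rewrite -ltNge => Md; rewrite ge_min lee_fin; apply/orP; right.
rewrite (bigD1 i) //=.
have -> : trunc_dist (p i) (q i) = M.
  by apply: EFin_inj; rewrite trunc_distE min_r // ltW.
by rewrite lerDl sumr_ge0 // => j _; exact: trunc_dist_ge0.
Qed.
End Truncation.

(** * Duality *)

Lemma sum_nth_padded (R : nmodType) (X : Type) (x0 : X) (k : X -> R) (s : seq X)
    (N : nat) : k x0 = 0 -> (size s <= N)%N ->
  \sum_(x <- s) k x = \sum_(i < N) k (nth x0 s i).
Proof.
move=> k0 sN; rewrite (big_nth x0) big_mkord.
rewrite (big_ord_widen _ (fun i => k (nth x0 s i)) sN) [LHS]big_mkcond /=.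
by apply: eq_bigr => i _; case: ltnP => // ?; rewrite nth_default.
Qed.

Section Duality.
Variables (R : realType) (X : choiceType) (d : metric R X) (x0 : X).
Variables (N : nat) (s t : seq X).

Lemma lipschitz1_le_matching_cost (k : X -> R) : lipschitz1 d k ->
  ((\sum_(i < N) (k (nth x0 s i) - k (nth x0 t i)))%:E
     <= matching_cost d x0 N s t)%E.
Proof.
move=> k_lip; apply: le_matching_cost => sigma.
rewrite sumrB [X in _ - X](reindex_perm sigma) -sumrB -sumEFin.
apply: lee_sum => i _; apply: le_trans (k_lip _ _).
by rewrite lee_fin ler_norm.
Qed.

(** Subtracting [k x0] normalises the potential; both sides of the matching
    have [N] points, so the dual value does not change. *)
Lemma matching_cost_trunc_dual (M : R) : 0 <= M ->
  exists2 k : X -> R, lipschitz1 d k /\ k x0 = 0 &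
    (Order.min (matching_cost d x0 N s t) M%:E <=
     (\sum_(i < N) (k (nth x0 s i) - k (nth x0 t i)))%:E)%E.
Proof.
move=> M_ge0; pose e := trunc_dist R X d M.
pose cost (sigma : 'S_N) :=
  \sum_(i < N) e (nth x0 s i) (nth x0 t (sigma i)).
have [//|sigma _ sigma_opt] := @arg_minP _ _ _ (1%g : 'S_N) predT cost.
have [||||k k_lip k_opt] := @optimal_matching_dual R X e _ _ _ N
  (fun i => nth x0 s i) (fun i => nth x0 t (sigma i)).
- exact: trunc_dist_refl.
- exact: trunc_dist_sym.
- exact: trunc_dist_triangle.
- move=> tau; apply: le_trans (sigma_opt (tau * sigma)%g isT) _.
  by apply: ler_sum => i _; rewrite permM.
exists (fun x => k x - k x0).
  split; last exact: subrr.
  apply: (trunc_dist_lipschitz1 _ _ _ M M_ge0) => x y.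
  by rewrite opprB addrA subrK.
apply: (@le_trans _ _ (cost sigma)%:E).
  apply: le_trans (trunc_dist_sum _ _ _ _ M_ge0 _ _ _).
  by rewrite le_min !ge_min matching_cost_le lexx orbT.
rewrite lee_fin (le_trans k_opt) //.
under [leRHS]eq_bigr do rewrite opprB addrA subrK.
by rewrite !sumrB [X in _ <= _ - X](reindex_perm sigma).
Qed.

End Duality.

(** For finite [x] one bound [M >= x] suffices; for [x = +oo] the hypothesis
    makes [y] exceed every real. *)
Lemma le_ereal_min_all (R : realType) (x y : \bar R) :
  (forall M : R, 0 <= M -> (Order.min x M%:E <= y)%E) -> (x <= y)%E.
Proof.
case: x => [r| |] xy; last by rewrite leNye.
  apply: le_trans (xy `|r| (normr_ge0 r)).
  by rewrite le_min lexx lee_fin ler_norm.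
case: y xy => [r xy|//|/(_ 0 (lexx 0))]; last by rewrite min_r ?leey.
have := xy (`|r| + 1) (addr_ge0 (normr_ge0 r) ler01).
by rewrite min_r ?leey // lee_fin leNgt ltr_pwDr // ler_norm.
Qed.

Theorem mainTheorem6 (R : realType) (X : choiceType) (d : metric R X) (x0 : X)
    (n m : nat) (a : 'I_n -> X) (b : 'I_m -> X) :
  W1 d (\sum_(i < n) gen x0 (a i)) (\sum_(j < m) gen x0 (b j)) =
  ereal_sup [set (\sum_(i < n) k (a i) - \sum_(j < m) k (b j))%:E
            | k in [set k : X -> R | lipschitz1 d k /\ k x0 = 0]]%classic.
Proof.
rewrite W1E /W1_seq; set N := (size _ + size _)%N.
have sumE (k : X -> R) : k x0 = 0 ->
    \sum_(i < n) k (a i) - \sum_(j < m) k (b j) =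
    \sum_(i < N) (k (nth x0 (codom a) i) - k (nth x0 (codom b) i)).
  move=> k0; rewrite sumrB -!sum_nth_padded ?leq_addr ?leq_addl //.
  by rewrite !codomE !big_map -!enumT !big_enum.
apply/eqP; rewrite eq_le; apply/andP; split; last first.
  apply: ge_ereal_sup => _ [k [k_lip k0] <-].
  by rewrite sumE // lipschitz1_le_matching_cost.
apply: le_ereal_min_all => M M_ge0.
have [k [k_lip k0] k_ge] :=
  matching_cost_trunc_dual _ _ d x0 N (codom a) (codom b) M M_ge0.
apply: le_trans k_ge _; rewrite -sumE //.
by apply: ereal_sup_ubound; exists k.
Qed.
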